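(* Let $d,n\in\mathbb{N}$, and let $f=f^*\in \mathrm{M}_d(\mathbb{C}\langle x_1,\dots,x_n\rangle)$ be a hermitian $d\times d$ matrix of noncommutative polynomials with $f(0)\succ 0$ (i.e., the hermitian matrix $f(0)\in\mathrm{M}_d(\mathbb{C})$ is positive definite). Then the free semialgebraic set $\mathcal{D}_f$ is convex if and only if it is a free spectrahedron.
   Context: Let $\mathbb{C}\langle \underline{x}\rangle=\mathbb{C}\langle x_1,\dots,x_n\rangle$ be the free $\mathbb{C}$-algebra on freely noncommuting variables $x_1,\dots,x_n$, with the unique skew-linear (conjugate-linear) involution $*$ (reversing products) such that $x_j^*=x_j$. Extend it to $\mathrm{M}_d(\mathbb{C}\langle \underline{x}\rangle)=\mathrm{M}_d(\mathbb{C})\otimes\mathbb{C}\langle \underline{x}\rangle$ as the conjugate transpose on $\mathrm{M}_d(\mathbb{C})$. Evaluation: for $f\in\mathrm{M}_d(\mathbb{C}\langle \underline{x}\rangle)$ and $\underline{X}=(X_1,\dots,X_n)\in\mathrm{M}_k(\mathbb{C})^n$, $f(\underline{X})\in\mathrm{M}_{dk}(\mathbb{C})$ is the image of $f$ under $\mathrm{id}\otimes\mathrm{ev}_{\underline{X}}:\mathrm{M}_d(\mathbb{C})\otimes\mathbb{C}\langle\underline{x}\rangle\to\mathrm{M}_d(\mathbb{C})\otimes\mathrm{M}_k(\mathbb{C})=\mathrm{M}_{dk}(\mathbb{C})$, where $\mathrm{ev}_{\underline{X}}$ is the unital algebra homomorphism with $x_j\mapsto X_j$. Here $f(0)$ is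 the evaluation at $(0,\dots,0)\in\mathbb{R}^n$ (size $k=1$). Let $\mathrm{H}_k(\mathbb{C})$ be the real vector space of hermitian $k\times k$ complex matrices. For $f=f^*$, the free semialgebraic set (positivity domain) of $f$ is $$\mathcal{D}_f=\bigcup_{k\in\mathbb{N}}\mathcal{D}_f(k),\qquad \mathcal{D}_f(k)=\{\underline{X}\in\mathrm{H}_k(\mathbb{C})^n : f(\underline{X})\succeq 0\},$$ where $k$ ranges over positive integers and $\succeq0$ means positive semidefinite. $\mathcal{D}_f$ is convex if $\mathcal{D}_f(k)$ is a convex subset of the real vector space $\mathrm{H}_k(\mathbb{C})^n$ for every $k\in\mathbb{N}$. A hermitian pencil of size $e$ is $L=A_0+A_1x_1+\cdots+A_nx_n$ with $A_0,\dots,A_n\in\mathrm{H}_e(\mathbb{C})$; thus $L(\underline{X})=A_0\otimes I+A_1\otimes X_1+\cdots+A_n\otimes X_n$. A free spectrahedron is a set of the form $\mathcal{D}_L$ for some hermitian pencil $L$ (of some finite size $e\in\mathbb{N}$). No boundedness of $\mathcal{D}_f$ is assumed. *)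

(* Defs.v *)
(* MathComp, with real-closed, multinomials and mathcomp-analysis. *)
From HB Require Import structures.
From mathcomp Require Import all_boot all_order all_algebra.
From mathcomp Require Import finmap complex mxtens.
From mathcomp Require Import classical_sets reals convex.
From mathcomp.multinomials Require Import monalg.

Set Implicit Arguments.
Unset Strict Implicit.
Unset Printing Implicit Defensive.

Import GRing.Theory Num.Theory.
Local Open Scope ring_scope.
Local Open Scope sesquilinear_scope.

Section PositiveMatrices.
Variable C : numClosedFieldType.

(* The order of C is partial: 0 <= z says that z is real and nonnegative. *)
Definition psdmx (m : nat) (A : 'M[C]_m) : Prop :=
  A \is hermsymmx /\
  forall v : 'cV[C]_m, 0 <= (v ^t* *m A *m v) 0 0.

Definition posdefmx (m : nat) (A : 'M[C]_m) : Prop :=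
  A \is hermsymmx /\
  forall v : 'cV[C]_m, v != 0 -> 0 < (v ^t* *m A *m v) 0 0.

End PositiveMatrices.

(* The free algebra on n generators over the complex numbers R[i], as the     *)
(* monoid algebra of the free monoid on 'I_n (R : realType).                  *)
Notation ncpoly R n := {malg R[i][{fmonom 'I_n}]}.

Section FreeSemialgebraicSets.
Variables (R : realType) (n : nat).
Local Notation C := R[i].

(* The conjugate-linear involution reversing words and fixing each variable. *)
Definition ncstar (p : ncpoly R n) : ncpoly R n :=
  \sum_(w <- msupp p) << (p@_w)^* *g FMonom (rev w) >>.

Definition mxstar (d : nat) (f : 'M[ncpoly R n]_d) : 'M[ncpoly R n]_d :=
  map_mx ncstar f^T.

(* Matrix sizes k >= 1 are written k.+1, so that 'M[C]_k.+1 is a nontrivial   *)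
(* ring; the parameter k below always stands for size k.+1.                   *)
Definition nceval (k : nat) (X : 'M[C]_k.+1 ^ n) (p : ncpoly R n) :
    'M[C]_k.+1 :=
  mmap scalar_mx (fun w : {fmonom 'I_n} => \prod_(j <- w) X j) p.

(* id (x) ev_X, decomposing f as the sum of the E_ij (x) f_ij. *)
Definition mxeval (k : nat) (X : 'M[C]_k.+1 ^ n) (d : nat)
    (f : 'M[ncpoly R n]_d) : 'M[C]_(d * k.+1) :=
  \sum_(i < d) \sum_(j < d) delta_mx i j *t nceval X (f i j).

Definition posdom (d : nat) (f : 'M[ncpoly R n]_d) (k : nat) :
    set ('M[C]_k.+1 ^ n) :=
  [set X : 'M[C]_k.+1 ^ n | (forall j, X j \is hermsymmx) /\ psdmx (mxeval X f)]%classic.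
Arguments posdom {d} f k _.

(* A free set is the family of its levels D k, indexed by all k.              *)
(* convex_set is taken over the numDomainType C, whose scalars t with         *)
(* 0 <= t <= 1 are exactly the real numbers of [0, 1]; this is thus convexity *)
(* in the underlying real vector space.                                       *)
Definition free_convex (D : forall k, set ('M[C]_k.+1 ^ n)) : Prop :=
  forall k, convex_set (D k : set (convex_lmodType ('M[C]_k.+1 ^ n)%type)).

(* A_0 + A_1 x_1 + ... + A_n x_n *)
Definition pencil (e : nat) (A0 : 'M[C]_e) (A : 'I_n -> 'M[C]_e) :
    'M[ncpoly R n]_e :=
  \matrix_(a, b) ((A0 a b)%:MP + \sum_(j < n) << A j a b *g fmu j >>).

Definition free_spectrahedron (D : forall k, set ('M[C]_k.+1 ^ n)) : Prop :=
  exists (e : nat) (A0 : 'M[C]_e) (A : 'I_n -> 'M[C]_e),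
    [/\ (0 < e)%N, A0 \is hermsymmx, forall j, A j \is hermsymmx
      & forall k, D k = posdom (pencil A0 A) k].

End FreeSemialgebraicSets.

Arguments posdom {R n d} f k _.

(* Main.v *)
Require Import Defs.
From HB Require Import structures.
From mathcomp Require Import all_boot all_order all_algebra.
From mathcomp Require Import finmap complex mxtens.
From mathcomp Require Import boolp classical_sets reals convex.
From mathcomp Require Import interval_inference.
From mathcomp Require Import lra.
From mathcomp.multinomials Require Import monalg.

Set Implicit Arguments.
Unset Strict Implicit.
Unset Printing Implicit Defensive.

Import Order.TTheory GRing.Theory Num.Theory.
Local Open Scope ring_scope.
Local Open Scope sesquilinear_scope.

(* Let omega be the column of all words of length <= m, where m bounds the    *)
(* degree of f. A hermitian pencil B of that size is nonnegative on D_f iff   *)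
(* it pairs nonnegatively with every moment tuple (G^* G, G^* X_j G),         *)
(* X \in D_f; these tuples form a convex cone. A functional phi extracting    *)
(* the quadratic form of f lives on the subspace of Hankel tuples, those for  *)
(* which x_j acts as a shift on the columns of G. Convexity of D_f makes phi  *)
(* nonnegative on Hankel moment tuples: if P is the projection onto the range *)
(* of G and S = 2 P - 1, the midpoint (X + S X S) / 2 of two points of D_f    *)
(* acts on that range as P X P and reproduces the tuple exactly. A small Fock *)
(* space tuple gives a Hankel order unit of the cone, so by M. Riesz'         *)
(* extension argument phi extends to a pencil B that is nonnegative on D_f    *)
(* and satisfies f = omega^* B omega. Hence D_B = D_f.                        *)

(** A pencil is affine in X, so its domain is convex ([pencil_convex]); this is the easy half. For
    the converse, the form of a pencil at G is the pairing of its coefficients with [moment X G]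
    ([qform_pencil_tuple]), so a pencil nonnegative on D_f is a functional nonnegative on
    [moment_cone f]. The functional to start from is [poly_tuple m f]: on the orbit of g it returns
    the form of f(X) at g ([tpair_poly]). Convexity makes it nonnegative on the Hankel part of the
    cone ([moment_poly_ge0]). Since f(0) is positive definite, small hermitian tuples lie in D_f
    ([small_dom]); a Fock space tuple among them gives a Hankel order unit ([fock_moment],
    [moment_order_unit]). Then [multipliers] corrects the functional by the Hankel equations until
    it is nonnegative on the whole cone ([nonneg_extension]). Nonnegativity of the result gives one
    inclusion between D_f and the spectrahedron, and its agreement with f on orbits the other. *)

Section Adjoint.
Variable C : numClosedFieldType.

Lemma hermP m (A : 'M[C]_m) : A \is hermsymmx <-> A^t* = A.
Proof.
split=> [/is_hermitianmxP|h]; first by rewrite expr0 scale1r => <-.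
by apply/is_hermitianmxP; rewrite expr0 scale1r.
Qed.

Lemma adjM m p q (A : 'M[C]_(m, p)) (B : 'M[C]_(p, q)) :
  (A *m B)^t* = B^t* *m A^t*.
Proof. by rewrite trmx_mul map_mxM. Qed.

Lemma adjD m p (A B : 'M[C]_(m, p)) : (A + B)^t* = A^t* + B^t*.
Proof. by rewrite linearD /= map_mxD. Qed.

Lemma adjB m p (A B : 'M[C]_(m, p)) : (A - B)^t* = A^t* - B^t*.
Proof. by rewrite linearB /= map_mxB. Qed.

Lemma adjZ m p c (A : 'M[C]_(m, p)) : (c *: A)^t* = c^* *: A^t*.
Proof. by rewrite linearZ /= map_mxZ. Qed.

Lemma adj1 m : (1%:M : 'M[C]_m)^t* = 1%:M.
Proof. by rewrite trmx1 map_mx1. Qed.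

Lemma adj0 m p : (0 : 'M[C]_(m, p))^t* = 0.
Proof. by rewrite trmx0 map_mx0. Qed.

Lemma adj_sum m p (I : Type) (r : seq I) (P : pred I) (F : I -> 'M[C]_(m, p)) :
  (\sum_(i <- r | P i) F i)^t* = \sum_(i <- r | P i) (F i)^t*.
Proof. by rewrite linear_sum /= map_mx_sum. Qed.

Lemma adjE m p (A : 'M[C]_(m, p)) i j : A^t* i j = (A j i)^*.
Proof. by rewrite !mxE. Qed.

Definition frobenius_sq m p (G : 'M[C]_(m, p)) : C := \sum_i \sum_j `|G i j| ^+ 2.

Lemma gram_trace m p (G : 'M[C]_(m, p)) : \tr (G^t* *m G) = frobenius_sq G.
Proof.
rewrite /frobenius_sq exchange_big /=; apply: eq_bigr => j _; rewrite mxE.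
by apply: eq_bigr => i _; rewrite adjE normCK mulrC.
Qed.

Lemma frobenius_sq_ge0 m p (G : 'M[C]_(m, p)) : 0 <= frobenius_sq G.
Proof. by do 2!apply: sumr_ge0 => ? _; rewrite exprn_ge0. Qed.

Lemma gram_eq0 m p (G : 'M[C]_(m, p)) : G^t* *m G = 0 -> G = 0.
Proof.
move=> h; have : frobenius_sq G = 0 by rewrite -gram_trace h mxtrace0.
move/psumr_eq0P => h1; apply/matrixP => i j; rewrite mxE.
have /psumr_eq0P h2 :=
  h1 (fun i _ => sumr_ge0 _ (fun j _ => exprn_ge0 2 (normr_ge0 _))) i isT.
have /eqP := h2 (fun j _ => exprn_ge0 2 (normr_ge0 _)) j isT.
by rewrite expf_eq0 /= normr_eq0 => /eqP.
Qed.

Lemma gram_unit m p (A : 'M[C]_(m, p)) :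
  row_free A^T -> A^t* *m A \in unitmx.
Proof.
move=> Afree; rewrite -row_free_unit -kermx_eq0.
set S := kermx _; have SA : S *m A^t* *m A = 0 by rewrite -mulmxA mulmx_ker.
have : (A *m S^t*)^t* *m (A *m S^t*) = 0.
  by rewrite adjM trmxCK !mulmxA SA mul0mx.
move/gram_eq0 => AS0; have : S^t*^T *m A^T = 0 by rewrite -trmx_mul AS0 trmx0.
move/eqP; rewrite mulmx_free_eq0 // => /eqP h.
by rewrite -[S]trmxCK -[S^t*]trmxK h trmx0 adj0.
Qed.

(** The orthogonal projection onto the column space, by the normal equations of a full-rank factor
    of [A]. Being hermitian of the form [A *m Q], it kills every vector orthogonal to the columns of
    [A], which is how [hankel_shift] uses it. *)
Lemma range_projector m p (A : 'M[C]_(m, p)) :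
  exists P : 'M[C]_m, exists Q : 'M[C]_(p, m),
    [/\ P^t* = P, P *m A = A & P = A *m Q].
Proof.
have [r [B [D [AE Bfree Dfree]]]] : exists r (B : 'M_(m, r)) (D : 'M_(r, p)),
    [/\ B *m D = A, row_free B^T & row_free D].
  exists (\rank A), (col_base A), (row_base A).
  split; rewrite ?mulmx_base ?row_base_free //.
  by have := col_base_full A; rewrite /row_free /row_full mxrank_tr.
have Gu : B^t* *m B \in unitmx by exact: gram_unit.
have GC : (invmx (B^t* *m B))^t* = invmx (B^t* *m B).
  by rewrite trmx_inv map_invmx adjM trmxCK.
have BD : B = A *m pinvmx D by rewrite -AE mulmxKp.
exists (B *m invmx (B^t* *m B) *m B^t*).
exists (pinvmx D *m invmx (B^t* *m B) *m B^t*); split.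
- by rewrite !adjM trmxCK GC mulmxA.
- by rewrite -AE -!mulmxA (mulmxA (B^t*)) (mulmxA (invmx _)) mulVmx // mul1mx.
- by rewrite {1}BD !mulmxA.
Qed.

Lemma spectral_factor m (A : 'M[C]_m) : A^t* = A ->
  exists U : 'M[C]_m, exists2 D : 'rV[C]_m, forall j, D 0 j \is Num.real &
    [/\ U^t* *m U = 1%:M, U *m U^t* = 1%:M & A = U^t* *m diag_mx D *m U].
Proof.
move=> Ah; have hA : A \is hermsymmx by apply/hermP.
have /orthomx_spectralP AE := hermitian_normalmx hA.
have Uu := spectral_unitarymx A.
have UV := invmx_unitary Uu; have Uunit := unitarymx_unit Uu.
exists (spectralmx A), (spectral_diag A).
  by move=> j; exact: (mxOverP (hermitian_spectral_diag_real hA)).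
by split; rewrite -?UV ?mulVmx ?mulmxV.
Qed.

Lemma diag_sqrt_factor m (U : 'M[C]_m) (D : 'rV[C]_m) :
  (forall j, 0 <= D 0 j) ->
  exists V : 'M[C]_m, U^t* *m diag_mx D *m U = V^t* *m V.
Proof.
move=> D0; exists (diag_mx (map_mx sqrtC D) *m U).
rewrite adjM -!mulmxA; congr (_ *m _); rewrite mulmxA; congr (_ *m _).
rewrite tr_diag_mx map_diag_mx mulmx_diag; congr diag_mx.
apply/rowP => j; rewrite !mxE.
have s0 : 0 <= sqrtC (D 0 j) by rewrite sqrtC_ge0.
rewrite -[D 0 j in LHS]sqrtCK expr2; congr (_ * _).
by apply/esym/CrealP/ger0_real.
Qed.

Lemma herm_upper_bound m (A : 'M[C]_m) : A^t* = A ->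
  exists2 c0, 0 < c0 &
    forall c, c0 <= c -> exists V : 'M[C]_m, c%:M - A = V^t* *m V.
Proof.
move=> /spectral_factor [U [D Dr [UU _ AE]]].
exists (1 + \sum_j `|D 0 j|) => [|c c0]; first by rewrite ltr_pwDl // sumr_ge0.
have [|V VE] := @diag_sqrt_factor _ U (const_mx c - D).
  move=> j; rewrite !mxE subr_ge0; apply: le_trans c0; rewrite (bigD1 j) //= addrCA.
  apply: le_trans (real_ler_norm (Dr j)) _; rewrite lerDl.
  by rewrite addr_ge0 // sumr_ge0.
exists V; rewrite -VE linearB /= mulmxBr mulmxBl -AE; congr (_ - _).
by rewrite diag_const_mx mul_mx_scalar -scalemxAl UU scalemx1.
Qed.

Lemma posdef_lower_bound m (A : 'M[C]_m) : posdefmx A ->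
  exists2 c, 0 < c & exists V : 'M[C]_m, A - c%:M = V^t* *m V.
Proof.
move=> [/hermP Ah Apos]; have [U [D Dr [UU UU' AE]]] := spectral_factor Ah.
have D0 j : 0 < D 0 j.
  pose v := U^t* *m (delta_mx j 0 : 'cV_m).
  have Uv : U *m v = delta_mx j 0 by rewrite mulmxA UU' mul1mx.
  have v0 : v != 0.
    apply/eqP => v0; move: Uv; rewrite v0 mulmx0 => /matrixP/(_ j 0).
    by rewrite !mxE !eqxx => /eqP; rewrite eq_sym oner_eq0.
  have := Apos v v0; rewrite AE -!mulmxA Uv !mulmxA.
  rewrite -adjM Uv mul_mx_diag !mxE (bigD1 j) //= big1 => [|i ij].
    by rewrite !mxE !eqxx /= conjC1 mul1r mulr1 addr0.
  by rewrite !mxE (negPf ij) /= conjC0 mul0r mulr0.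
(* A lower bound of all eigenvalues without taking a minimum; the 1 keeps it positive in size 0. *)
pose c := (1 + \sum_j (D 0 j)^-1)^-1.
have S0 : 0 < 1 + \sum_j (D 0 j)^-1.
  by rewrite ltr_pwDl // sumr_ge0 // => j _; rewrite invr_ge0 ltW.
have [|V VE] := @diag_sqrt_factor _ U (D - const_mx c).
  move=> j; rewrite !mxE subr_ge0 /c -[X in _ <= X]invrK lef_pV2 ?posrE ?invr_gt0 //.
  rewrite (bigD1 j) //= addrCA lerDl addr_ge0 // sumr_ge0 // => i _.
  by rewrite invr_ge0 ltW.
exists c; first by rewrite invr_gt0.
exists V; rewrite -VE linearB /= mulmxBr mulmxBl -AE; congr (_ - _).
by rewrite diag_const_mx mul_mx_scalar -scalemxAl UU scalemx1.
Qed.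
End Adjoint.

(** * Complex polarization *)

Section Polarization.
Variable C : numClosedFieldType.

(** The vectors u + w and u + i w show that the sesquilinear form of [B] is both antisymmetric and
    symmetric, hence zero. *)
Lemma quad0_mx0 m (B : 'M[C]_m) :
  (forall v : 'cV_m, (v^t* *m B *m v) 0 0 = 0) -> B = 0.
Proof.
move=> B0; suff h (u w : 'cV_m) : (u^t* *m B *m w) 0 0 = 0.
  apply: gram_eq0; apply/matrixP => i j; rewrite [RHS]mxE.
  have := h (B *m delta_mx i 0) (delta_mx j 0).
  rewrite adjM -(mulmxA _ _ B) trmx_delta map_delta_mx -rowE -colE => <-.
  by rewrite [RHS]mxE [RHS]mxE.
pose s (x y : 'cV_m) := (x^t* *m B *m y) 0 0.
have sD x y x' y' : s (x + y) (x' + y') = s x x' + s x y' + (s y x' + s y y').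
  rewrite /s adjD !(mulmxDl, mulmxDr) 3!mxE.
  by rewrite [X in _ + X = _]mxE addrACA.
have sZl c x y : s (c *: x) y = c^* * s x y.
  by rewrite /s adjZ -!scalemxAl mxE.
have sZr c x y : s x (c *: y) = c * s x y by rewrite /s -scalemxAr mxE.
have s0 x : s x x = 0 by exact: B0.
have := s0 (u + w); have := s0 (u + 'i *: w).
rewrite !sD !s0 !add0r !addr0 sZl sZr conjCi mulNr -mulrBr => /eqP.
rewrite mulf_eq0 (negPf (neq0Ci C)) /= subr_eq0 => /eqP h2 h1.
by move: h1; rewrite -h2 -mulr2n => /eqP; rewrite mulrn_eq0 => /eqP.
Qed.

Lemma real_quad_herm m (A : 'M[C]_m) :
  (forall v : 'cV_m, (v^t* *m A *m v) 0 0 \is Num.real) -> A^t* = A.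
Proof.
move=> Ar; apply/eqP; rewrite -subr_eq0; apply/eqP/quad0_mx0 => v.
rewrite mulmxBr mulmxBl mxE [X in _ + X]mxE.
have -> : v^t* *m A^t* *m v = (v^t* *m A *m v)^t*.
  by rewrite !adjM trmxCK mulmxA.
by rewrite adjE; apply/eqP; rewrite subr_eq0; apply/eqP/CrealP.
Qed.
End Polarization.

(** * Evaluation of polynomials and positivity as a quadratic form *)

Section Evaluation.
Variables (R : realType) (n : nat).
Local Notation C := R[i].
Implicit Types (k d : nat).

Definition mon k (X : 'M[C]_k.+1 ^ n) (w : seq 'I_n) : 'M[C]_k.+1 :=
  \prod_(j <- w) X j.

(* The quadratic form of f(X) at the vector of C^d (x) C^k whose components   *)
(* are the columns of G.                                                      *)
Definition qform k (X : 'M[C]_k.+1 ^ n) d (f : 'M[ncpoly R n]_d)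
    (G : 'M[C]_(k.+1, d)) : C :=
  \sum_a \sum_b (G^t* *m nceval X (f a b) *m G) a b.

Definition hermtuple k (X : 'M[C]_k.+1 ^ n) : Prop :=
  forall j, (X j)^t* = X j.

(** Working form of [posdom], free of Kronecker products; [posdomP] recovers that f(X) is hermitian
    from its form being real. *)
Definition dom d (f : 'M[ncpoly R n]_d) k (X : 'M[C]_k.+1 ^ n) : Prop :=
  hermtuple X /\ forall G, 0 <= qform X f G.

Lemma mxevalE k (X : 'M[C]_k.+1 ^ n) d (f : 'M[ncpoly R n]_d) a b i j :
  mxeval X f (mxtens_index (a, i)) (mxtens_index (b, j)) =
  nceval X (f a b) i j.
Proof.
rewrite /mxeval summxE (bigD1 a) //= summxE (bigD1 b) //= !tensmxE mxE !eqxx.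
rewrite mul1r !big1 ?addr0 // => [a' aa'|b' bb'].
  rewrite summxE big1 // => b' _.
  by rewrite tensmxE mxE eq_sym (negPf aa') mul0r.
by rewrite tensmxE mxE eqxx eq_sym (negPf bb') mul0r.
Qed.

Lemma mxeval_qform k (X : 'M[C]_k.+1 ^ n) d (f : 'M[ncpoly R n]_d)
    (G : 'M[C]_(k.+1, d)) (v : 'cV[C]_(d * k.+1)) :
  (forall a i, v (mxtens_index (a, i)) 0 = G i a) ->
  (v^t* *m mxeval X f *m v) 0 0 = qform X f G.
Proof.
move=> vG; have reidx (F : 'I_(d * k.+1) -> C) :
    \sum_p F p = \sum_a \sum_i F (mxtens_index (a, i)).
  rewrite pair_big /=; apply: reindex; exists (@mxtens_unindex d k.+1) => p _.
    by rewrite mxtens_indexK; case: p.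
  by rewrite -[RHS]mxtens_unindexK.
rewrite mxE reidx /qform [RHS]exchange_big /=; apply: eq_bigr => b _.
under eq_bigr do rewrite mxE reidx.
transitivity (\sum_j \sum_a \sum_i
   (G i a)^* * nceval X (f a b) i j * G j b).
  apply: eq_bigr => j _; rewrite vG mulr_suml; apply: eq_bigr => a _.
  rewrite mulr_suml; apply: eq_bigr => i _.
  by rewrite adjE vG mxevalE.
rewrite exchange_big; apply: eq_bigr => a _; rewrite mxE.
apply: eq_bigr => j _; rewrite mxE mulr_suml; apply: eq_bigr => i _.
by rewrite adjE.
Qed.

Lemma posdomP d (f : 'M[ncpoly R n]_d) k (X : 'M[C]_k.+1 ^ n) :
  posdom f k X <-> dom f X.
Proof.
split=> [[Xh [_ pos]]|[Xh pos]].
  split=> [j|G]; first exact/hermP.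
  pose v : 'cV[C]_(d * k.+1) :=
    \col_p G (mxtens_unindex p).2 (mxtens_unindex p).1.
  by rewrite -(@mxeval_qform _ _ _ _ _ v) // => a i; rewrite mxE mxtens_indexK.
have pos' (v : 'cV[C]_(d * k.+1)) : 0 <= (v^t* *m mxeval X f *m v) 0 0.
  have := pos (\matrix_(i, a) v (mxtens_index (a, i)) 0).
  by rewrite -(@mxeval_qform _ _ _ _ _ v) // => a i; rewrite mxE.
split=> [j|]; first exact/hermP.
by split=> //; apply/hermP/real_quad_herm => v; apply: ger0_real.
Qed.

Lemma nceval_coef k (X : 'M[C]_k.+1 ^ n) (p : ncpoly R n) :
  nceval X p = \sum_(w <- msupp p) p@_w *: mon X w.
Proof.
by rewrite /nceval mmapE; apply: eq_bigr => w _; rewrite -mul_scalar_mx.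
Qed.

Lemma mon_cons k (X : 'M[C]_k.+1 ^ n) j w : mon X (j :: w) = X j *m mon X w.
Proof. by rewrite /mon big_cons. Qed.

Lemma mon_nil k (X : 'M[C]_k.+1 ^ n) : mon X [::] = 1%:M.
Proof. by rewrite /mon big_nil. Qed.

Lemma mon_adj k (X : 'M[C]_k.+1 ^ n) w : hermtuple X ->
  (mon X w)^t* = mon X (rev w).
Proof.
move=> Xh; elim: w => [|j w IH]; first by rewrite mon_nil adj1.
rewrite mon_cons adjM IH Xh rev_cons /mon -cats1 big_cat big_seq1.
by [].
Qed.

Lemma nceval_star k (X : 'M[C]_k.+1 ^ n) p : hermtuple X ->
  nceval X (ncstar p) = (nceval X p)^t*.
Proof.
move=> Xh; rewrite [in RHS]nceval_coef adj_sum /ncstar /nceval raddf_sum.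
apply: eq_bigr => w _; rewrite /= mmapU adjZ mon_adj // -mul_scalar_mx.
by [].
Qed.

Lemma qform_real k (X : 'M[C]_k.+1 ^ n) d (f : 'M[ncpoly R n]_d) G :
  mxstar f = f -> hermtuple X -> qform X f G \is Num.real.
Proof.
move=> fh Xh; apply/CrealP; rewrite /qform [in RHS]exchange_big raddf_sum.
apply: eq_bigr => a _; rewrite raddf_sum; apply: eq_bigr => b _.
rewrite -[LHS]adjE !adjM trmxCK mulmxA -nceval_star //.
by have /matrixP/(_ b a) := fh; rewrite !mxE => ->.
Qed.
End Evaluation.

(** * Extension of positive functionals by Lagrange multipliers *)

Section Multipliers.
Local Open Scope complex_scope.
Variables (R : realType) (V : lmodType R[i]).

Definition real_linear (phi : V -> R) : Prop :=
  {morph phi : x y / x + y} /\ forall (t : R) x, phi (t%:C *: x) = t * phi x.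

Variables (K : V -> Prop) (u : V).
Hypothesis KD : forall x y, K x -> K y -> K (x + y).
Hypothesis KZ : forall (t : R) x, 0 < t -> K x -> K (t%:C *: x).
Hypothesis Ku : forall x, K x -> exists2 c : R, 0 < c & K (c%:C *: u - x).

Lemma real_linearB phi : real_linear phi -> {morph phi : x y / x - y}.
Proof.
move=> [phiD phiZ] x y; rewrite phiD; congr (_ + _).
by have := phiZ (-1) y; rewrite rmorphN1 scaleN1r mulN1r.
Qed.

(* The multiplier is the supremum of the slopes - phi x / chi x; the order    *)
(* unit ensures that chi takes both signs on S or vanishes there.             *)
Lemma one_multiplier (S : V -> Prop) phi chi :
    (forall x, S x -> K x) ->
    (forall x y, S x -> S y -> S (x + y)) ->
    (forall (t : R) x, 0 < t -> S x -> S (t%:C *: x)) ->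
    (forall x, S x -> exists2 c : R, 0 < c & S (c%:C *: u - x)) ->
    real_linear phi -> real_linear chi -> chi u = 0 ->
    (forall x, S x -> chi x = 0 -> 0 <= phi x) ->
  exists lam : R, forall x, S x -> 0 <= phi x + lam * chi x.
Proof.
move=> SK SD SZ Su phil chil chiu pos.
have opp x : S x -> exists2 y, S y & chi y = - chi x.
  move=> /Su [c c0 Sc]; exists (c%:C *: u - x) => //.
  by rewrite real_linearB // (proj2 chil) chiu mulr0 sub0r.
have slopes x y : S x -> S y -> 0 < chi x -> chi y < 0 ->
    - phi x / chi x <= phi y / - chi y.
  move=> Sx Sy x0 y0; have y0' : 0 < - chi y by rewrite oppr_gt0.
  rewrite ler_pdivrMr // mulrAC ler_pdivlMr //.
  (* The positive combination of [x] and [y] on which [chi] vanishes. *)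
  have : 0 <= phi ((- chi y)%:C *: x + (chi x)%:C *: y).
    apply: pos; first by apply: SD; apply: SZ.
    by rewrite (proj1 chil) !(proj2 chil) mulNr mulrC addNr.
  by rewrite (proj1 phil) !(proj2 phil); lra.
have [[x0 Sx0 cx0]|none] := pselect (exists2 x, S x & 0 < chi x).
  pose A := [set r | exists2 x, S x /\ 0 < chi x & r = - phi x / chi x]%classic.
  have ubA y : S y -> chi y < 0 -> ubound A (phi y / - chi y).
    by move=> Sy cy _ [x [Sx cx] ->]; exact: slopes.
  have A0 : nonempty A by exists (- phi x0 / chi x0), x0.
  have [y0 Sy0 cy0] := opp x0 Sx0.
  have supA : has_sup A.
    by split=> //; exists (phi y0 / - chi y0); apply: ubA; rewrite // cy0 oppr_lt0.
  exists (sup A) => x Sx; have [xpos|xneg|xz] := ltgtP (chi x) 0; last first.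
  - by rewrite xz mulr0 addr0; exact: pos.
  - have : - phi x / chi x <= sup A by apply: ub_le_sup; [case: supA|exists x].
    by rewrite ler_pdivrMr // -subr_ge0 opprK addrC.
  - have : sup A <= phi x / - chi x by apply: ge_sup => //; exact: ubA.
    by rewrite ler_pdivlMr ?oppr_gt0 // mulrN -subr_ge0 opprK.
exists 0 => x Sx; rewrite mul0r addr0; apply: pos => //.
apply/eqP; case: ltgtP => // cx; exfalso; apply: none; last by exists x.
by have [y Sy cy] := opp x Sx; exists y; rewrite // cy oppr_gt0.
Qed.

(** Induction on [p]: on the subcone cut out by the first [p] constraints, [one_multiplier] absorbs
    [chi p] into [phi], and the induction hypothesis handles the new functional. As every [chi i]
    vanishes at [u], it remains an order unit for the subcone. *)
Lemma multipliers p (chi : nat -> V -> R) phi :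
    real_linear phi -> (forall i, real_linear (chi i)) ->
    (forall i, chi i u = 0) ->
    (forall x, K x -> (forall i, (i < p)%N -> chi i x = 0) -> 0 <= phi x) ->
  exists lam : nat -> R,
    forall x, K x -> 0 <= phi x + \sum_(i < p) lam i * chi i x.
Proof.
move=> + chil chiu; elim: p phi => [|p IH] phi phil pos.
  by exists (fun=> 0) => x Kx; rewrite big_ord0 addr0; exact: pos.
pose S x := K x /\ forall i, (i < p)%N -> chi i x = 0.
have [||||x [Kx x0] xp|lam lamP] :=
  @one_multiplier S phi (chi p) _ _ _ _ phil (chil p) (chiu p).
- by move=> x [].
- move=> x y [Kx x0] [Ky y0]; split=> [|i ip]; first exact: KD.
  by rewrite (proj1 (chil i)) x0 // y0 // addr0.
- move=> t x t0 [Kx x0]; split=> [|i ip]; first exact: KZ.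
  by rewrite (proj2 (chil i)) x0 // mulr0.
- move=> x [Kx x0]; have [c c0 Kc] := Ku Kx; exists c => //; split=> // i ip.
  by rewrite real_linearB // (proj2 (chil i)) chiu x0 // mulr0 subr0.
- by apply: pos => // i; rewrite ltnS leq_eqVlt => /predU1P[->|/x0].
have [|x Kx x0|mu muP] := IH (fun x => phi x + lam * chi p x).
- split=> [x y|t x].
    by rewrite (proj1 phil) (proj1 (chil p)) mulrDr addrACA.
  by rewrite (proj2 phil) (proj2 (chil p)) mulrDr mulrCA.
- by apply: lamP.
exists (fun i => if i == p then lam else mu i) => x Kx.
rewrite big_ord_recr /= eqxx [X in _ + X]addrC addrA.
rewrite (eq_bigr (fun i : 'I_p => mu i * chi i x)) => [|i _]; first exact: muP.
by rewrite (ltn_eqF (ltn_ord i)).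
Qed.
End Multipliers.

(** * The bilinear pairing of matrices and norm bounds *)

Section Pairing.
Variable C : numClosedFieldType.

Definition mxpair e (A H : 'M[C]_e) : C := \sum_a \sum_b A a b * H a b.

Lemma mxpairDl e (A B H : 'M[C]_e) : mxpair (A + B) H = mxpair A H + mxpair B H.
Proof.
rewrite -big_split; apply: eq_bigr => a _; rewrite -big_split.
by apply: eq_bigr => b _; rewrite mxE mulrDl.
Qed.

Lemma mxpairDr e (A H H' : 'M[C]_e) :
  mxpair A (H + H') = mxpair A H + mxpair A H'.
Proof.
rewrite -big_split; apply: eq_bigr => a _; rewrite -big_split.
by apply: eq_bigr => b _; rewrite mxE mulrDr.
Qed.

Lemma mxpairZl e c (A H : 'M[C]_e) : mxpair (c *: A) H = c * mxpair A H.
Proof.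
rewrite mulr_sumr; apply: eq_bigr => a _; rewrite mulr_sumr.
by apply: eq_bigr => b _; rewrite mxE mulrA.
Qed.

Lemma mxpairZr e c (A H : 'M[C]_e) : mxpair A (c *: H) = c * mxpair A H.
Proof.
rewrite mulr_sumr; apply: eq_bigr => a _; rewrite mulr_sumr.
by apply: eq_bigr => b _; rewrite mxE mulrCA.
Qed.

Lemma mxpair_adj e (A H : 'M[C]_e) : mxpair (A^t*) (H^t*) = (mxpair A H)^*.
Proof.
rewrite /mxpair exchange_big raddf_sum; apply: eq_bigr => a _.
by rewrite raddf_sum; apply: eq_bigr => b _; rewrite /= rmorphM !adjE.
Qed.

Lemma mxpair_scalar e c (H : 'M[C]_e) : mxpair c%:M H = c * \tr H.
Proof.
rewrite mulr_sumr; apply: eq_bigr => a _; rewrite (bigD1 a) //= mxE eqxx big1.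
  by rewrite addr0.
by move=> b ab; rewrite mxE eq_sym (negPf ab) mul0r.
Qed.

Lemma mxpair_gram e m p (V : 'M[C]_(m, e)) (G : 'M[C]_(p, e)) :
  mxpair (V^t* *m V) (G^t* *m G) = frobenius_sq (V *m G^T).
Proof.
rewrite /frobenius_sq /mxpair.
transitivity (\sum_a \sum_b \sum_i \sum_j
    ((V i a * G j a)^* * (V i b * G j b))).
  apply: eq_bigr => a _; apply: eq_bigr => b _; rewrite !mxE mulr_suml.
  apply: eq_bigr => i _; rewrite mulr_sumr; apply: eq_bigr => j _.
  by rewrite !adjE rmorphM /= mulrACA.
under eq_bigr => a _ do rewrite exchange_big.
rewrite exchange_big; apply: eq_bigr => i _ /=.
under eq_bigr => a _ do rewrite exchange_big.
rewrite exchange_big; apply: eq_bigr => j _ /=.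
rewrite normCK mulrC mxE.
rewrite raddf_sum mulr_suml; apply: eq_bigr => a _.
by rewrite mulr_sumr mxE; apply: eq_bigr => b _; rewrite mxE.
Qed.

Lemma entry_le_frobenius_sq m p (G : 'M[C]_(m, p)) i j :
  `|G i j| ^+ 2 <= frobenius_sq G.
Proof.
rewrite /frobenius_sq (bigD1 i) //= (bigD1 j) //= -addrA lerDl addr_ge0 //.
  by apply: sumr_ge0 => ? _; rewrite exprn_ge0.
by do 2!apply: sumr_ge0 => ? _; rewrite exprn_ge0.
Qed.

Lemma sandwich_bound m p (S : 'M[C]_m) (G : 'M[C]_(m, p)) a b :
  `|(G^t* *m S *m G) a b| <= (\sum_i \sum_j `|S i j|) * frobenius_sq G.
Proof.
rewrite mxE; under eq_bigr => j _ do rewrite mxE mulr_suml.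
rewrite exchange_big mulr_suml; apply: le_trans (ler_norm_sum _ _ _) _.
apply: ler_sum => i _; rewrite mulr_suml.
apply: le_trans (ler_norm_sum _ _ _) _; apply: ler_sum => j _.
rewrite adjE !normrM norm_conjC mulrAC mulrC ler_wpM2l //.
rewrite -(@ler_pXn2r _ 2) ?nnegrE ?mulr_ge0 ?frobenius_sq_ge0 //.
by rewrite exprMn expr2 ler_pM ?exprn_ge0 // entry_le_frobenius_sq.
Qed.
End Pairing.

(** * Closure of D_f under reflections, direct sums and midpoints *)

Section Domain.
Variables (R : realType) (n d : nat) (f : 'M[ncpoly R n]_d).
Local Notation C := R[i].

Lemma qform_coef k (X : 'M[C]_k.+1 ^ n) G :
  qform X f G = \sum_a \sum_b \sum_(w <- msupp (f a b))
    (f a b)@_w * (G^t* *m mon X w *m G) a b.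
Proof.
apply: eq_bigr => a _; apply: eq_bigr => b _.
rewrite nceval_coef mulmx_sumr mulmx_suml summxE; apply: eq_bigr => w _.
by rewrite -scalemxAr -scalemxAl mxE.
Qed.

Lemma mon_reflection k (X : 'M[C]_k.+1 ^ n) (S : 'M[C]_k.+1) w :
  S *m S = 1%:M -> mon [ffun j => S *m X j *m S] w = S *m mon X w *m S.
Proof.
move=> SS; elim: w => [|j w IH]; first by rewrite !mon_nil mulmx1 SS.
by rewrite !mon_cons IH ffunE !mulmxA -(mulmxA _ S S) SS mulmx1.
Qed.

(** Adjacent factors [S] cancel inside each word, so the form of f(SXS) at [G] is that of f(X) at
    [S *m G]. *)
Lemma dom_reflection k (X : 'M[C]_k.+1 ^ n) (S : 'M[C]_k.+1) :
  S^t* = S -> S *m S = 1%:M -> dom f X -> dom f [ffun j => S *m X j *m S].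
Proof.
move=> Sh SS [Xh pos]; split=> [j|G].
  by rewrite ffunE !adjM Xh Sh mulmxA.
have := pos (S *m G); rewrite !qform_coef; congr (_ <= _).
apply: eq_bigr => a _; apply: eq_bigr => b _; apply: eq_bigr => w _.
by rewrite mon_reflection // adjM Sh !mulmxA.
Qed.

Definition dsum k1 k2 (X1 : 'M[C]_k1.+1 ^ n) (X2 : 'M[C]_k2.+1 ^ n) :
    ('M[C]_((k1 + k2.+1).+1) ^ n)%type :=
  [ffun j => block_mx (X1 j) 0 0 (X2 j) : 'M_(k1.+1 + k2.+1)].

Lemma mon_dsum k1 k2 (X1 : 'M[C]_k1.+1 ^ n) (X2 : 'M[C]_k2.+1 ^ n) w :
  mon (dsum X1 X2) w =
  (block_mx (mon X1 w) 0 0 (mon X2 w) : 'M_(k1.+1 + k2.+1)).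
Proof.
elim: w => [|j w IH]; first by rewrite !mon_nil -scalar_mx_block.
rewrite !mon_cons IH ffunE.
transitivity (block_mx (X1 j) 0 0 (X2 j) *m block_mx (mon X1 w) 0 0 (mon X2 w)
  : 'M_(k1.+1 + k2.+1)); first by [].
by rewrite mulmx_block !mulmx0 !mul0mx !addr0 !add0r.
Qed.

Lemma sandwich_block m1 m2 p (A1 : 'M[C]_m1) (A2 : 'M[C]_m2)
    (G : 'M[C]_(m1 + m2, p)) :
  G^t* *m block_mx A1 0 0 A2 *m G =
  (usubmx G)^t* *m A1 *m usubmx G + (dsubmx G)^t* *m A2 *m dsubmx G.
Proof.
rewrite -{1 2}[G]vsubmxK tr_col_mx map_row_mx mul_row_block !mulmx0 addr0 add0r.
by rewrite mul_row_col.
Qed.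

Lemma dom_dsum k1 k2 (X1 : 'M[C]_k1.+1 ^ n) (X2 : 'M[C]_k2.+1 ^ n) :
  dom f X1 -> dom f X2 -> dom f (dsum X1 X2).
Proof.
move=> [X1h pos1] [X2h pos2]; split=> [j|G].
  have blockh : (block_mx (X1 j) 0 0 (X2 j))^t* = block_mx (X1 j) 0 0 (X2 j).
    by rewrite tr_block_mx map_block_mx X1h X2h !adj0.
  by rewrite ffunE; exact: blockh.
pose G' : 'M_(k1.+1 + k2.+1, d) := G.
have := addr_ge0 (pos1 (usubmx G')) (pos2 (dsubmx G')).
rewrite !qform_coef -big_split; congr (_ <= _).
apply: eq_bigr => a _; rewrite -big_split; apply: eq_bigr => b _ /=.
rewrite -big_split; apply: eq_bigr => w _ /=.
rewrite mon_dsum -mulrDr; congr (_ * _).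
have addE (A B : 'M[C]_d) : A a b + B a b = (A + B) a b by rewrite mxE.
by rewrite addE -sandwich_block.
Qed.

Lemma dom_midpoint k (X Y : 'M[C]_k.+1 ^ n) :
  free_convex (posdom f) -> dom f X -> dom f Y -> dom f (2^-1 *: (X + Y)).
Proof.
move=> cvx /posdomP /mem_set Xf /posdomP /mem_set Yf; apply/posdomP.
have h0 : (0 : C) <= 2^-1 by rewrite invr_ge0 ler0n.
have h1 : (2^-1 : C) <= 1 by rewrite invf_le1 ?ltr0n ?ler1n.
have := cvx k X Y (Itv01 h0 h1) Xf Yf.
rewrite in_setE; congr (posdom f k _); rewrite scalerDr; congr (_ + _ *: _).
transitivity (1 - 2^-1 : C); first by [].
by rewrite {1}(splitr 1) mul1r addrK.
Qed.
End Domain.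

(** * Small hermitian tuples lie in D_f *)

Section NearZero.
Variables (R : realType) (n d : nat) (f : 'M[ncpoly R n]_d).
Local Notation C := R[i].

Local Notation fmnil := (FMonom [::] : {fmonom 'I_n}).

Definition const_coef : 'M[C]_d := \matrix_(a, b) (f a b)@_fmnil.

Lemma nceval_split k (X : 'M[C]_k.+1 ^ n) (p : ncpoly R n) :
  nceval X p = (p@_fmnil)%:M +
    \sum_(w <- msupp p | w != fmnil) p@_w *: mon X w.
Proof.
rewrite nceval_coef (bigID (fun w => w == fmnil)) /=; congr (_ + _).
have [p1|p1] := boolP (fmnil \in msupp p).
  rewrite big_fset_condE /= (_ : [fset _ | _ in _ & _]%fset = [fset fmnil]%fset).
    by rewrite big_seq_fset1 mon_nil scalemx1.
  apply/fsetP => w; rewrite !inE /=.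
  by case: eqP => [->|]; rewrite ?p1 ?andbF.
rewrite (mcoeff_outdom p1) big1_seq => [|w /andP[/eqP -> wp]].
  by rewrite raddf0.
by rewrite wp in p1.
Qed.

Lemma qform_split k (X : 'M[C]_k.+1 ^ n) G :
  qform X f G = mxpair const_coef (G^t* *m G) +
    \sum_a \sum_b \sum_(w <- msupp (f a b) | w != fmnil)
      (f a b)@_w * (G^t* *m mon X w *m G) a b.
Proof.
rewrite /qform /mxpair -big_split; apply: eq_bigr => a _.
rewrite -big_split; apply: eq_bigr => b _.
rewrite nceval_split mulmxDr mulmxDl [LHS]mxE; congr (_ + _).
  by rewrite mul_mx_scalar -scalemxAl mxE [const_coef a b]mxE.
rewrite mulmx_sumr mulmx_suml summxE; apply: eq_bigr => w _.
by rewrite -scalemxAr -scalemxAl mxE.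
Qed.

Lemma monZ k (X : 'M[C]_k.+1 ^ n) (t : C) w :
  mon (t *: X) w = t ^+ size w *: mon X w.
Proof.
elim: w => [|j w IH]; first by rewrite !mon_nil expr0 scale1r.
by rewrite !mon_cons IH ffunE -scalemxAr -scalemxAl scalerA -exprSr.
Qed.

Hypothesis f_herm : mxstar f = f.
Hypothesis f0_posdef : posdefmx (mxeval (0 : 'M[C]_1 ^ n) f).

Lemma const_coef_posdef : posdefmx const_coef.
Proof.
have mon0 (w : {fmonom 'I_n}) : w != fmnil -> mon (0 : 'M[C]_1 ^ n) w = 0.
  case: w => -[|j w]; first by rewrite eqxx.
  by rewrite mon_cons ffunE mul0mx.
have qE G : qform (0 : 'M[C]_1 ^ n) f G = mxpair const_coef (G^t* *m G).
  rewrite qform_split [X in _ + X]big1 ?addr0 // => a _; rewrite big1 // => b _.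
  by rewrite big1 // => w w1; rewrite mon0 // mulmx0 mul0mx mxE mulr0.
have pE (v : 'cV[C]_d) :
    (v^t* *m const_coef *m v) 0 0 = mxpair const_coef (v^T^t* *m v^T).
  rewrite mxE /mxpair [RHS]exchange_big; apply: eq_bigr => b _.
  rewrite mxE mulr_suml; apply: eq_bigr => a _.
  have -> : (v^T^t* *m v^T) a b = (v a 0)^* * v b 0.
    by rewrite mxE big_ord1 !mxE.
  by rewrite adjE mulrAC mulrC.
split; last first.
  move=> v v0; rewrite pE -qE.
  pose u : 'cV[C]_(d * 1) := \col_p v (mxtens_unindex p).1 0.
  rewrite -(@mxeval_qform _ _ _ _ _ _ _ u) => [|a i]; last first.
    by rewrite !mxE mxtens_indexK (ord1 i).
  apply: (proj2 f0_posdef); apply: contraNneq v0 => u0.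
  apply/eqP/colP => a; have /colP/(_ (mxtens_index (a, 0))) := u0.
  by rewrite !mxE mxtens_indexK.
apply/hermP/real_quad_herm => v; rewrite pE -qE; apply: qform_real => // j.
by rewrite ffunE adj0.
Qed.

(** The constant term of the form is at least [c * frobenius_sq G], by positive definiteness of
    f(0). The nonempty words contribute at most [t * B * frobenius_sq G], since powers of [t <= 1]
    are at most [t]; the choice of [t] gives [t * B <= c]. *)
Lemma small_dom k (Z : 'M[C]_k.+1 ^ n) :
  hermtuple Z -> exists2 t : C, 0 < t & dom f (t *: Z).
Proof.
move=> Zh; have [c c0 [V VE]] := posdef_lower_bound const_coef_posdef.
pose B := \sum_a \sum_b \sum_(w <- msupp (f a b) | w != fmnil)
  `|(f a b)@_w| * \sum_i \sum_j `|mon Z w i j|.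
have B0 : 0 <= B.
  do 3![apply: sumr_ge0 => ? _]; rewrite mulr_ge0 //.
  by do 2![apply: sumr_ge0 => ? _].
have cB : 0 < c + B by rewrite ltr_wpDr.
pose t := c / (c + B); have t0 : 0 < t by rewrite divr_gt0.
have t1 : t <= 1 by rewrite ler_pdivrMr // mul1r lerDl.
have tB : t * B <= c.
  by rewrite mulrAC ler_pdivrMr // ler_wpM2l ?lerDr // ltW.
exists t => //.
have tZh : hermtuple (t *: Z).
  by move=> j; rewrite ffunE adjZ Zh (CrealP (ger0_real (ltW t0))).
split=> // G; have := qform_real G f_herm tZh; rewrite qform_split.
set P := mxpair _ _; set Q := \sum_a _ => PQr.
have P_ge : c * frobenius_sq G <= P.
  rewrite /P -[const_coef](subrK c%:M) VE mxpairDl mxpair_gram mxpair_scalar.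
  by rewrite gram_trace lerDr frobenius_sq_ge0.
have Pr : P \is Num.real.
  by apply: ger0_real; apply: le_trans P_ge; rewrite mulr_ge0 ?frobenius_sq_ge0 ?ltW.
have Qr : Q \is Num.real by rewrite -(addKr P Q) addrC rpredB.
have Q_le : `|Q| <= t * B * frobenius_sq G.
  rewrite (mulrC t) -mulrA /Q /B mulr_suml.
  apply: le_trans (ler_norm_sum _ _ _) _; apply: ler_sum => a _.
  rewrite mulr_suml.
  apply: le_trans (ler_norm_sum _ _ _) _; apply: ler_sum => b _.
  rewrite mulr_suml.
  apply: le_trans (ler_norm_sum _ _ _) _; apply: ler_sum => w w1.
  rewrite normrM -mulrA (mulrCA _ t); apply: ler_wpM2l => //.
  rewrite monZ -scalemxAr -scalemxAl mxE normrM.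
  apply: ler_pM => //; last exact: sandwich_bound.
  rewrite ger0_norm; last by rewrite exprn_ge0 // ltW.
  case: w w1 => -[|j w]; first by rewrite eqxx.
  move=> _; rewrite /= exprS; apply: ler_piMr; first exact: ltW.
  by apply: exprn_ile1 => //; exact: ltW.
have : - Q <= P.
  apply: le_trans P_ge; apply: le_trans (real_ler_norm _) _; rewrite ?rpredN //.
  by rewrite normrN; apply: le_trans Q_le _; rewrite ler_wpM2r ?frobenius_sq_ge0.
by rewrite -subr_ge0 opprK.
Qed.
End NearZero.

(** * Pencils and convexity of their domains *)

Section Pencils.
Variables (R : realType) (n e : nat).
Local Notation C := R[i].
Variables (A0 : 'M[C]_e) (A : 'I_n -> 'M[C]_e).

Lemma qform_pencil k (X : 'M[C]_k.+1 ^ n) G :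
  qform X (pencil A0 A) G =
  mxpair A0 (G^t* *m G) + \sum_j mxpair (A j) (G^t* *m X j *m G).
Proof.
have pE a b : nceval X (pencil A0 A a b) =
    (A0 a b)%:M + \sum_j A j a b *: X j.
  rewrite mxE /nceval mmapD raddf_sum; congr (_ + _).
    by rewrite [LHS]mmapU fm1 big_nil mulr1.
  apply: eq_bigr => j _; rewrite /= mmapU -mul_scalar_mx fmuE.
  by rewrite /mon /= big_seq1.
rewrite /qform /mxpair [X in _ = _ + X]exchange_big -big_split.
apply: eq_bigr => a _; rewrite /= [X in _ = _ + X]exchange_big -big_split.
apply: eq_bigr => b _ /=.
rewrite pE mulmxDr mulmxDl [LHS]mxE; congr (_ + _).
  by rewrite mul_mx_scalar -scalemxAl mxE.
rewrite mulmx_sumr mulmx_suml summxE; apply: eq_bigr => j _.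
by rewrite -scalemxAr -scalemxAl mxE.
Qed.

Lemma qform_pencil_comb k (X Y : 'M[C]_k.+1 ^ n) G (s t : C) : s + t = 1 ->
  qform (s *: X + t *: Y) (pencil A0 A) G =
  s * qform X (pencil A0 A) G + t * qform Y (pencil A0 A) G.
Proof.
move=> st; rewrite !qform_pencil !mulrDr addrACA -mulrDl st mul1r; congr (_ + _).
rewrite !mulr_sumr -big_split; apply: eq_bigr => j _ /=.
rewrite !ffunE mulmxDr mulmxDl -!scalemxAr -!scalemxAl.
by rewrite mxpairDr !mxpairZr.
Qed.

Lemma pencil_convex : free_convex (posdom (pencil A0 A)).
Proof.
move=> k X Y t /set_mem XD /set_mem YD; apply: mem_set.
have [[Xh Xpos] [Yh Ypos]] := (proj1 (posdomP _ X) XD, proj1 (posdomP _ Y) YD).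
apply/posdomP; pose s : C := t%:num; pose s' := 1 - s.
have s0 : 0 <= s by rewrite /s.
have s'0 : 0 <= s' by rewrite subr_ge0 /s.
change (dom (pencil A0 A) (s *: X + s' *: Y)).
split=> [j|G].
  by rewrite !ffunE adjD !adjZ Xh Yh !(CrealP _) ?ger0_real.
rewrite qform_pencil_comb; last by rewrite addrC subrK.
by rewrite addr_ge0 // mulr_ge0.
Qed.
End Pencils.

Lemma free_spectrahedron_convex (R : realType) (n : nat)
    (D : forall k, set ('M[R[i]]_k.+1 ^ n)) :
  free_spectrahedron D -> free_convex D.
Proof.
by move=> [e [A0 [A [_ _ _ DE]]]] k; rewrite DE; exact: pencil_convex.
Qed.

(** * Moment tuples and their duality with pencils *)

Section MomentTuples.
Variables (R : realType) (n e : nat).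
Local Notation C := R[i].
Local Notation tuple := {ffun option 'I_n -> 'M[C]_e}.

(* The coefficient of x_j, or the constant coefficient for None. *)
Definition moment_def k (X : 'M[C]_k.+1 ^ n) (G : 'M[C]_(k.+1, e)) : tuple :=
  [ffun i => G^t* *m (if i is Some j then X j else 1%:M) *m G].

(** The opaque key keeps conversion from unfolding [moment]; access is through [momentE]. *)
Fact moment_key : unit. Proof. by []. Qed.
Definition moment := locked_with moment_key moment_def.

Lemma momentE k (X : 'M[C]_k.+1 ^ n) G i :
  moment X G i = G^t* *m (if i is Some j then X j else 1%:M) *m G.
Proof. by rewrite /moment unlock ffunE. Qed.

Lemma tupleD (H H' : tuple) i : (H + H') i = H i + H' i.
Proof. by rewrite ffunE. Qed.

Lemma tupleB (H H' : tuple) i : (H - H') i = H i - H' i.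
Proof. by rewrite !ffunE. Qed.

Lemma tupleZ c (H : tuple) i : (c *: H) i = c *: H i.
Proof. by rewrite ffunE. Qed.

Definition tpair (B H : tuple) : C := \sum_i mxpair (B i) (H i).

Lemma tpairE (B H : tuple) :
  tpair B H = mxpair (B None) (H None) +
    \sum_j mxpair (B (Some j)) (H (Some j)).
Proof.
rewrite /tpair (bigD1 None) //=; congr (_ + _).
rewrite (reindex_omap Some id) => [|[j|]] //=.
by apply: eq_bigl => j; rewrite eqxx.
Qed.

Lemma tpairDl B B' H : tpair (B + B') H = tpair B H + tpair B' H.
Proof.
by rewrite -big_split; apply: eq_bigr => i _; rewrite ffunE mxpairDl.
Qed.

Lemma tpairDr B H H' : tpair B (H + H') = tpair B H + tpair B H'.
Proof.
by rewrite -big_split; apply: eq_bigr => i _; rewrite ffunE mxpairDr.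
Qed.

Lemma tpairZl c B H : tpair (c *: B) H = c * tpair B H.
Proof.
by rewrite mulr_sumr; apply: eq_bigr => i _; rewrite ffunE mxpairZl.
Qed.

Lemma tpairZr c B H : tpair B (c *: H) = c * tpair B H.
Proof.
by rewrite mulr_sumr; apply: eq_bigr => i _; rewrite ffunE mxpairZr.
Qed.

Lemma tpair_adj (B H : tuple) :
  (forall i, (H i)^t* = H i) ->
  tpair [ffun i => (B i)^t*] H = (tpair B H)^*.
Proof.
move=> Hh; rewrite raddf_sum; apply: eq_bigr => i _.
by rewrite /= -mxpair_adj ffunE Hh.
Qed.

Lemma moment_adj k (X : 'M[C]_k.+1 ^ n) G i :
  hermtuple X -> (moment X G i)^t* = moment X G i.
Proof.
move=> Xh; rewrite momentE !adjM trmxCK mulmxA.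
by case: i => [j|]; rewrite ?Xh ?adj1.
Qed.

Lemma moment_dsum k1 k2 (X1 : 'M[C]_k1.+1 ^ n) (X2 : 'M[C]_k2.+1 ^ n)
    (G1 : 'M[C]_(k1.+1, e)) (G2 : 'M[C]_(k2.+1, e)) :
  moment (dsum X1 X2) (col_mx G1 G2) = moment X1 G1 + moment X2 G2.
Proof.
apply/ffunP => i; rewrite tupleD !momentE.
have := @sandwich_block _ _ _ _ (if i is Some j then X1 j else 1%:M)
  (if i is Some j then X2 j else 1%:M) (col_mx G1 G2).
rewrite col_mxKu col_mxKd => <-; congr (_ *m _ *m _).
by case: i => [j|]; rewrite ?ffunE -?scalar_mx_block.
Qed.

Lemma moment_scale k (X : 'M[C]_k.+1 ^ n) G (t : C) : 0 <= t ->
  moment X (sqrtC t *: G) = t *: moment X G.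
Proof.
move=> t0; apply/ffunP => i; rewrite tupleZ !momentE adjZ.
rewrite -scalemxAr -!scalemxAl scalerA.
by rewrite (CrealP _) ?ger0_real ?sqrtC_ge0 // -expr2 sqrtCK.
Qed.

Lemma qform_pencil_tuple k (X : 'M[C]_k.+1 ^ n) (A : tuple) G :
  qform X (pencil (A None) (fun j => A (Some j))) G = tpair A (moment X G).
Proof.
rewrite qform_pencil tpairE momentE mulmx1; congr (_ + _).
by apply: eq_bigr => j _; rewrite momentE.
Qed.
End MomentTuples.

(** * Words of bounded length as matrix indices *)

Section Words.
Variables (n d m : nat).

(* Basis of the row polynomials of degree at most m: a word of length at most *)
(* m together with a coordinate of C^d.                                       *)
Definition nbasis := #|{: {bseq m of 'I_n} * 'I_d}|.

(** A word longer than [m] falls to the default of [insub_bseq], hence the length guards wherever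
    [bindex] or [bshift] is read back. *)
Definition bindex (w : seq 'I_n) (a : 'I_d) : 'I_nbasis :=
  enum_rank (insub_bseq m w, a).

Definition bword (i : 'I_nbasis) : seq 'I_n := (enum_val i).1.
Definition bcoord (i : 'I_nbasis) : 'I_d := (enum_val i).2.

Lemma bword_index w a : (size w <= m)%N -> bword (bindex w a) = w.
Proof. by move=> wm; rewrite /bword enum_rankK /= val_insubd wm. Qed.

Lemma bcoord_index w a : bcoord (bindex w a) = a.
Proof. by rewrite /bcoord enum_rankK. Qed.

Lemma size_bword i : (size (bword i) <= m)%N.
Proof. exact: size_bseq. Qed.

Lemma bindexK i : bindex (bword i) (bcoord i) = i.
Proof.
rewrite /bindex /bword /bcoord -[RHS]enum_valK; congr enum_rank.
case: (enum_val i) => w a /=; congr (_, _).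
by apply/val_inj; rewrite /= val_insubd size_bseq.
Qed.

(* The index of x_j times the i-th basis element. *)
Definition bshift (j : 'I_n) i := bindex (j :: bword i) (bcoord i).
End Words.

(** * Hankel tuples and positivity of f on them *)

Section Hankel.
Variables (R : realType) (n d m : nat).
Local Notation C := R[i].
Local Notation e := (nbasis n d m).
Local Notation tuple := {ffun option 'I_n -> 'M[C]_e}.

(** Models the moments of an orbit, where X_j sends the column of a word w to that of x_j w; the
    guard keeps x_j w within length [m]. *)
Definition hankel (H : tuple) : Prop := forall j b (i : 'I_e),
  (size (bword i) < m)%N -> H (Some j) b i = H None b (bshift j i).

Lemma mulmx_col_entry p q r (A : 'M[C]_(p, q)) (B : 'M[C]_(q, r)) i j :
  (A *m B) i j = (A *m col j B) i 0.
Proof. by rewrite !mxE; apply: eq_bigr => l _; rewrite !mxE. Qed.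

Lemma adjmul_col_entry p q r (A : 'M[C]_(p, q)) (B : 'M[C]_(p, r)) i j :
  (A^t* *m B) i j = ((col i A)^t* *m B) 0 j.
Proof. by rewrite !mxE; apply: eq_bigr => l _; rewrite !mxE. Qed.

(** The truncated noncommutative Krylov matrix generated by the columns of [g]. *)
Definition orbit k (X : 'M[C]_k.+1 ^ n) (g : 'M[C]_(k.+1, d)) :
    'M[C]_(k.+1, e) :=
  \matrix_(l, i) (mon X (bword i) *m g) l (bcoord i).

Lemma col_orbit k (X : 'M[C]_k.+1 ^ n) g i :
  col i (orbit X g) = mon X (bword i) *m col (bcoord i) g.
Proof. by apply/colP => l; rewrite [LHS]mxE [LHS]mxE mulmx_col_entry. Qed.

Lemma col_orbit_index k (X : 'M[C]_k.+1 ^ n) g w a : (size w <= m)%N ->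
  col (bindex m w a) (orbit X g) = mon X w *m col a g.
Proof. by move=> wm; rewrite col_orbit bword_index // bcoord_index. Qed.

Lemma orbit_shift k (X : 'M[C]_k.+1 ^ n) g j i : (size (bword i) < m)%N ->
  X j *m col i (orbit X g) = col (bshift j i) (orbit X g).
Proof.
move=> im; rewrite col_orbit col_orbit_index // mon_cons -mulmxA.
by [].
Qed.

Lemma hankel_moment k (X : 'M[C]_k.+1 ^ n) (G : 'M[C]_(k.+1, e)) :
  (forall j i, (size (bword i) < m)%N -> X j *m col i G = col (bshift j i) G) ->
  hankel (moment X G).
Proof.
move=> shift j b i im; rewrite !momentE mulmx1 mulmx_col_entry -mulmxA shift //.
by rewrite -mulmx_col_entry.
Qed.

(* The compression of X to the range of G acts as a shift on the columns of G.*)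
Lemma hankel_shift k (X : 'M[C]_k.+1 ^ n) (G : 'M[C]_(k.+1, e)) (P : 'M[C]_k.+1)
    (Q : 'M[C]_(e, k.+1)) j i :
  hankel (moment X G) -> P^t* = P -> P *m G = G -> P = G *m Q ->
  (size (bword i) < m)%N ->
  P *m X j *m col i G = col (bshift j i) G.
Proof.
move=> hk Ph PG PE im; apply/eqP; rewrite -subr_eq0.
have -> : col (bshift j i) G = P *m col (bshift j i) G.
  by rewrite colE mulmxA PG.
rewrite -mulmxA -mulmxBr -Ph PE adjM -mulmxA; apply/eqP.
suff -> : G^t* *m (X j *m col i G - col (bshift j i) G) = 0 by rewrite mulmx0.
apply/colP => b; rewrite mulmxBr mulmxA [RHS]mxE [LHS]mxE [X in _ + X]mxE.
have := hk j b i im; rewrite !momentE mulmx1 !(mulmx_col_entry _ G) => ->.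
by rewrite subrr.
Qed.

Variable f : 'M[ncpoly R n]_d.
Hypothesis f_size : forall a b w, w \in msupp (f a b) -> (size w <= m)%N.

(** Each monomial is placed whole on the column side, against the empty word, so words up to the
    degree of [f] suffice as indices. *)
Definition poly_tuple : tuple :=
  [ffun i => if i is None then
     \sum_a \sum_b \sum_(w <- msupp (f a b))
       (f a b)@_w *: delta_mx (bindex m [::] a) (bindex m w b)
   else 0].

Lemma mxpair_delta (H : 'M[C]_e) i j : mxpair (delta_mx i j) H = H i j.
Proof.
rewrite /mxpair (bigD1 i) //= (bigD1 j) //= mxE !eqxx mul1r !big1 ?addr0 //.
  by move=> i' ii'; rewrite big1 // => j' _; rewrite mxE (negPf ii') mul0r.
by move=> j' jj'; rewrite mxE (negPf jj') andbF mul0r.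
Qed.

Lemma mxpair0 (H : 'M[C]_e) : mxpair 0 H = 0.
Proof.
rewrite /mxpair big1 // => a _; rewrite big1 // => b _.
by rewrite mxE mul0r.
Qed.

Lemma mxpair_sum (I : Type) (r : seq I) (A : I -> 'M[C]_e) H :
  mxpair (\sum_(x <- r) A x) H = \sum_(x <- r) mxpair (A x) H.
Proof.
by elim/big_rec2: _ => [|x y A' _ <-]; rewrite ?mxpair0 // mxpairDl.
Qed.

(** [Y] may differ from [X] because only the constant component of [poly_tuple] is nonzero;
    [moment_poly_ge0] takes for [X] its averaged tuple. *)
Lemma tpair_poly k (X Y : 'M[C]_k.+1 ^ n) (G : 'M[C]_(k.+1, e)) g :
  (forall w a, (size w <= m)%N -> col (bindex m w a) G = mon X w *m col a g) ->
  tpair poly_tuple (moment Y G) = qform X f g.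
Proof.
move=> colG; rewrite tpairE momentE ffunE [X in _ + X]big1 ?addr0 => [|j _]; last first.
  by rewrite ffunE mxpair0.
rewrite mulmx1 qform_coef mxpair_sum; apply: eq_bigr => a _.
rewrite mxpair_sum; apply: eq_bigr => b _.
rewrite mxpair_sum !big_seq; apply: eq_bigr => w wf.
rewrite mxpairZl mxpair_delta; congr (_ * _).
rewrite mulmx_col_entry colG ?(f_size wf) // adjmul_col_entry colG // mon_nil.
by rewrite mul1mx -adjmul_col_entry mulmxA -mulmx_col_entry.
Qed.

Hypothesis f_cvx : free_convex (posdom f).

(** The averaged tuple [Z] stays in D_f by convexity, and the Hankel relations make its words
    regenerate [G] from the columns [g] of the empty word. The pairing is therefore the form of f(Z)
    at [g]. *)
Lemma moment_poly_ge0 k (Y : 'M[C]_k.+1 ^ n) (G : 'M[C]_(k.+1, e)) :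
  dom f Y -> hankel (moment Y G) -> 0 <= tpair poly_tuple (moment Y G).
Proof.
move=> Yf hk; have [P [Q [Ph PG PE]]] := range_projector G.
have PP : P *m P = P by rewrite {2}PE mulmxA PG -PE.
(* The reflection in the range of [G]: averaging [Y] with its conjugate by [S] removes the blocks
   between that range and its orthogonal complement. *)
pose S := 2 *: P - 1%:M.
have Sh : S^t* = S.
  by rewrite adjB adjZ Ph adj1 (CrealP _) ?ger0_real.
have SP : S *m P = P.
  rewrite mulmxBl mul1mx -scalemxAl PP -{2}[P]scale1r -scalerBl.
  by rewrite -addrA subrr addr0 scale1r.
have SS : S *m S = 1%:M.
  by rewrite {2}/S mulmxBr mulmx1 -scalemxAr SP opprB addrC subrK.
have SG : S *m G = G by rewrite -PG mulmxA SP PG.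
pose Z := 2^-1 *: (Y + [ffun j => S *m Y j *m S]).
have Zf : dom f Z := dom_midpoint f_cvx Yf (dom_reflection Sh SS Yf).
(* [S] fixes the columns of [G], so the average acts there as (1 + S) Y / 2 = P Y. *)
have ZG j i : Z j *m col i G = P *m Y j *m col i G.
  rewrite !ffunE -scalemxAl mulmxDl -(mulmxA _ S).
  have -> : S *m col i G = col i G by rewrite colE mulmxA SG.
  rewrite {1}/S mulmxBl mul1mx mulmxBl addrC subrK -2!scalemxAl scalerA.
  by rewrite mulVf ?scale1r // pnatr_eq0.
pose g := \matrix_(l, a) G l (bindex m [::] a).
have gE a : col a g = col (bindex m [::] a) G.
  by apply/colP => l; rewrite !mxE.
have colG w a : (size w <= m)%N -> col (bindex m w a) G = mon Z w *m col a g.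
  elim: w => [|j w IH] wm; first by rewrite mon_nil mul1mx gE.
  rewrite mon_cons -mulmxA -IH ?(ltnW wm) // ZG.
  rewrite (hankel_shift _ hk Ph PG PE) /bshift ?bword_index ?(ltnW wm) //.
  by rewrite bcoord_index.
by rewrite (tpair_poly _ colG); exact: (proj2 Zf).
Qed.
End Hankel.

(** * The moment cone and its order units *)

Section OrderUnit.
Local Open Scope complex_scope.
Variables (R : realType) (n d : nat) (f : 'M[ncpoly R n]_d).
Local Notation C := R[i].
Hypothesis f_herm : mxstar f = f.
Hypothesis f0_posdef : posdefmx (mxeval (0 : 'M[C]_1 ^ n) f).
Hypothesis f_cvx : free_convex (posdom f).

Definition moment_cone e (H : {ffun option 'I_n -> 'M[C]_e}) : Prop :=
  exists k (X : 'M[C]_k.+1 ^ n) (G : 'M[C]_(k.+1, e)), dom f X /\ H = moment X G.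

Lemma moment_coneD e (H H' : {ffun option 'I_n -> 'M[C]_e}) :
  moment_cone H -> moment_cone H' -> moment_cone (H + H').
Proof.
move=> [k [X [G [Xf ->]]]] [k' [X' [G' [Xf' ->]]]].
exists (k + k'.+1)%N, (dsum X X'), (col_mx G G'); split; first exact: dom_dsum.
by rewrite moment_dsum.
Qed.

Lemma moment_coneZ e (t : C) (H : {ffun option 'I_n -> 'M[C]_e}) :
  0 <= t -> moment_cone H -> moment_cone (t *: H).
Proof.
move=> t0 [k [X [G [Xf ->]]]]; exists k, X, (sqrtC t *: G); split=> //.
by rewrite moment_scale.
Qed.

Lemma dom0 k : dom f (0 : 'M[C]_k.+1 ^ n).
Proof.
have [|t _] := small_dom f_herm f0_posdef (Z := 0 : 'M[C]_k.+1 ^ n).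
  by move=> j; rewrite ffunE adj0.
by rewrite scaler0.
Qed.

Lemma dom_scale k (X : 'M[C]_k.+1 ^ n) (t : C) :
  0 <= t -> t <= 1 -> dom f X -> dom f (t *: X).
Proof.
move=> t0 t1 /(proj2 (posdomP _ _))/mem_set Xf.
have /(proj2 (posdomP _ _))/mem_set Of := dom0 k.
have /set_mem := f_cvx (Itv01 t0 t1) Xf Of.
move=> /(proj1 (posdomP _ _)); congr (dom f _).
transitivity (t *: X + (1 - t) *: (0 : 'M[C]_k.+1 ^ n)); first by [].
by rewrite scaler0 addr0.
Qed.

(** With G = T G0, the difference splits into a moment at the zero tuple, which carries the surplus
    c - T^* T = V^* V of the constant part, and c times a moment at W = 2 X0 - Z / c. This W is the
    midpoint of 4 X0 and -2 Z / c, both in D_f. *)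
Lemma moment_order_unit e k0 (X0 : 'M[C]_k0.+1 ^ n) (G0 : 'M[C]_(k0.+1, e)) Q0 :
    dom f ((2 * 2) *: X0) -> Q0 *m G0 = 1%:M ->
  forall H, moment_cone H ->
    exists2 c : R, 0 < c & moment_cone (c%:C *: moment X0 G0 - H).
Proof.
move=> X0f QG H [k [Y [G [[Yh _] ->]]]].
have [T TG] : exists T, T *m G0 = G.
  by exists (G *m Q0); rewrite -mulmxA QG mulmx1.
have [|c0 c00 c0P] := @herm_upper_bound _ _ (T^t* *m T).
  by rewrite adjM trmxCK.
pose Z : 'M[C]_k0.+1 ^ n := [ffun j => T^t* *m Y j *m T].
have Zh : hermtuple (- Z).
  by move=> j; rewrite !ffunE -sub0r adjB adj0 !adjM trmxCK Yh mulmxA.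
have [s s0 sZ] := small_dom f_herm f0_posdef Zh.
(* [c0] serves the factorization of c - T^* T; 2 / s makes -2 Z / c a contraction of -s Z, which
   lies in D_f. *)
pose c := c0 + 2 / s; have s20 : 0 < 2 / s by rewrite divr_gt0.
have cpos : 0 < c by rewrite addr_gt0.
have cV : c * c^-1 = 1 by rewrite mulfV // gt_eqF.
have [V VE] := c0P c (ltac:(by rewrite lerDl ltW)).
have sZc : dom f (2 / c *: - Z).
  have -> : 2 / c *: - Z = (2 / s / c) *: (s *: - Z).
    by rewrite scalerA mulrAC divfK // gt_eqF.
  apply: dom_scale => //; first by rewrite divr_ge0 // ltW.
  by rewrite ler_pdivrMr // mul1r lerDr ltW.
pose W := 2 *: X0 - c^-1 *: Z.
have Wf : dom f W.
  have := dom_midpoint f_cvx X0f sZc; congr (dom f _).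
  rewrite /W scalerDr !scalerA !mulrA mulVf ?pnatr_eq0 // !mul1r scalerN.
  by [].
have c2E : (complex.Re (2 * c))%:C = 2 * c.
  by apply: RRe_real; rewrite ger0_real // mulr_ge0 // ltW.
exists (complex.Re (2 * c)); first by rewrite -ltcR c2E mulr_gt0.
rewrite c2E.
have -> : (2 * c) *: moment X0 G0 - moment Y G =
    moment (0 : 'M[C]_k0.+1 ^ n) (V *m G0) + c *: moment W G0.
  apply/ffunP => i; rewrite tupleB tupleD !tupleZ !momentE.
  have VGE : (V *m G0)^t* *m (V *m G0) = c *: (G0^t* *m G0) - G^t* *m G.
    rewrite adjM mulmxA -(mulmxA _ (V^t*)) -VE mulmxBr mulmxBl mul_mx_scalar.
    by rewrite -scalemxAl -!mulmxA TG mulmxA -adjM TG.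
  case: i => [j|].
    rewrite !ffunE mulmx0 mul0mx add0r mulmxBr mulmxBl -!scalemxAr -!scalemxAl.
    rewrite scalerBr 2!scalerA cV scale1r (mulrC c); congr (_ - _).
    by rewrite -!mulmxA TG !mulmxA -adjM TG.
  rewrite !mulmx1 VGE addrAC -scalerDl; congr (_ *: _ - _).
  by rewrite mulr_natl mulr2n.
apply: moment_coneD; last first.
  by apply: moment_coneZ; [exact: ltW | exists k0, W, G0].
by exists k0, 0, (V *m G0); split; first exact: dom0.
Qed.
End OrderUnit.

(** * A Hankel order unit from the truncated Fock space *)

Section Fock.
Variables (R : realType) (n d m : nat) (f : 'M[ncpoly R n]_d).
Local Notation C := R[i].
Local Notation e := (nbasis n d m).
Hypothesis f_herm : mxstar f = f.
Hypothesis f0_posdef : posdefmx (mxeval (0 : 'M[C]_1 ^ n) f).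

(* Creation plus annihilation by x_j on the truncated full Fock space. *)
Definition fock_field (j : 'I_n) : 'M[C]_e :=
  \matrix_(a, b) ((a == bshift j b) && (size (bword b) < m)%N ||
                  (b == bshift j a) && (size (bword a) < m)%N)%:R.

Lemma fock_field_herm j : (fock_field j)^t* = fock_field j.
Proof. by apply/matrixP => a b; rewrite adjE !mxE conjC_nat orbC. Qed.

(** The field of x_j sends the basis vector of a word w to that of x_j w plus at most a term for a
    shorter word. By induction on length, the columns of [G] for words of length at most [l] span
    the basis vectors of all such words. *)
Lemma fock_cyclic (t : C) (G : 'M[C]_e) : t != 0 ->
    (forall a, col (bindex m [::] a) G = delta_mx (bindex m [::] a) 0) ->
    (forall j b, (size (bword b) < m)%N ->
       col (bshift j b) G = t *: (fock_field j *m col b G)) ->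
  G \in unitmx.
Proof.
move=> t0 G0 GS; rewrite -unitmx_tr -row_full_unit -sub1mx.
pose S l := (\sum_(b | (size (bword b) <= l)%N) <<row b G^T>>)%MS.
have rowS l b : (size (bword b) <= l)%N -> (row b G^T <= S l)%MS.
  by move=> bl; apply: (sumsmx_sup b); rewrite ?genmxE.
have S_mono l : (S l <= S l.+1)%MS.
  by apply/sumsmx_subP => b bl; rewrite genmxE; apply: rowS; exact: leqW.
have S_step j l : (l < m)%N -> (S l *m (fock_field j)^T <= S l.+1)%MS.
  move=> lm; rewrite sumsmxMr; apply/sumsmx_subP => b bl.
  rewrite (eqmxMr _ (genmxE _)).
  have bm : (size (bword b) < m)%N := leq_ltn_trans bl lm.
  rewrite -tr_col -trmx_mul (_ : _ *m _ = t^-1 *: col (bshift j b) G).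
    rewrite linearZ /= tr_col; apply/scalemx_sub/rowS.
    by rewrite bword_index.
  by rewrite GS // scalerA mulVf // scale1r.
have deltaS l : (l <= m)%N -> forall b, (size (bword b) <= l)%N ->
    ((delta_mx 0 b : 'rV[C]_e) <= S l)%MS.
  elim: l => [_|l IH lm] b.
    rewrite leqn0 size_eq0 => /eqP b0; have := rowS 0%N b.
    by rewrite -(bindexK b) b0 -tr_col G0 trmx_delta bword_index // => ->.
  rewrite leq_eqVlt => /predU1P[bl|]; last first.
    by move=> bl; apply: submx_trans (S_mono l); apply: IH; rewrite ?(ltnW lm).
  case bE : (bword b) bl => [|j w] //= [wl].
  pose c := bindex m w (bcoord b).
  have cw : bword c = w by rewrite bword_index // wl ltnW.
  have cb : bshift j c = b.
    by rewrite /bshift cw bcoord_index -bE bindexK.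
  have cm : (size (bword c) < m)%N by rewrite cw wl.
  set v := (delta_mx 0 c : 'rV[C]_e) *m (fock_field j)^T.
  have vS : (v <= S l.+1)%MS.
    apply: submx_trans (S_step j l lm); apply/submxMr/IH; rewrite ?(ltnW lm) //.
    by rewrite cw wl.
  rewrite -[delta_mx 0 b](subrK v) addmx_sub // -opprB eqmx_opp.
  rewrite [v - _]row_sum_delta; apply: summx_sub => a _.
  (* The annihilation term: it survives only if [a] is [c] with its leading letter x_j removed. *)
  have -> : (v - delta_mx 0 b) 0 a =
      ((a != b) && (c == bshift j a) && (size (bword a) < m)%N)%:R.
    rewrite /v -rowE !mxE eqxx cb /=.
    case: eqP => [->|_] /=; first by rewrite cm subrr.
    by rewrite subr0.
  case: andP => [[/andP[_ /eqP ca] am]|_]; last by rewrite scale0r sub0mx.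
  apply/scalemx_sub/(submx_trans _ (S_mono l))/IH; first exact: ltnW.
  by move: wl; rewrite -cw ca bword_index //= => <-; rewrite leqnSn.
have -> : 1%:M = \matrix_(b < e) (delta_mx 0 b : 'rV[C]_e).
  by apply/row_matrixP => b; rewrite rowK row1.
apply/row_subP => b; rewrite rowK.
apply: submx_trans (deltaS m (leqnn m) b (size_bword b)) _.
by apply/sumsmx_subP => c _; rewrite genmxE row_sub.
Qed.

(** Orbits have Hankel moments, and the orbit of the vacuum vectors has a left inverse by
    [fock_cyclic]; the factor 4 is the one in [moment_order_unit]. *)
Lemma fock_moment : exists k (X : 'M[C]_k.+1 ^ n) (G : 'M[C]_(k.+1, e)) Q,
  [/\ dom f ((2 * 2) *: X), Q *m G = 1%:M & hankel (moment X G)].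
Proof.
(* An isometry into one more dimension, since matrix tuples have size [k.+1]. *)
pose D : 'M[C]_(e.+1, e) := pid_mx e.
have DD : D^t* *m D = 1%:M.
  rewrite tr_pid_mx map_pid_mx mul_pid_mx -pid_mx_1; congr pid_mx.
  by rewrite minnn (minn_idPr (leqnSn e)).
pose F : 'M[C]_e.+1 ^ n := [ffun j => D *m fock_field j *m D^t*].
have Fh : hermtuple F.
  by move=> j; rewrite ffunE !adjM trmxCK fock_field_herm mulmxA.
have [s s0 sF] := small_dom f_herm f0_posdef Fh.
pose t := s / (2 * 2); have t0 : t != 0.
  by rewrite mulf_neq0 ?gt_eqF // invr_gt0 mulr_gt0.
pose X : 'M[C]_e.+1 ^ n := t *: F.
pose g : 'M[C]_(e.+1, d) := D *m \matrix_(b, a) (b == bindex m [::] a)%:R.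
have shift := @orbit_shift _ _ _ m _ X g.
have Gu : D^t* *m orbit m X g \in unitmx.
  apply: (fock_cyclic t0) => [a|j b bm].
    rewrite colE -mulmxA -colE col_orbit_index // mon_nil mul1mx colE !mulmxA DD.
    rewrite mul1mx -colE; apply/colP => b; rewrite !mxE.
    by rewrite eqxx andbT.
  rewrite !colE -!(mulmxA (D^t*)) -!colE -shift // ffunE ffunE.
  by rewrite -scalemxAl -scalemxAr !mulmxA DD mul1mx.
exists e, X, (orbit m X g), (invmx (D^t* *m orbit m X g) *m D^t*); split.
- by rewrite scalerA mulrC divfK // mulf_neq0 // pnatr_eq0.
- by rewrite -mulmxA mulVmx.
- exact: hankel_moment.
Qed.
End Fock.

(** * The Hankel condition as finitely many real linear equations *)

Section HankelEquations.
Variables (R : realType) (n d m : nat).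
Local Open Scope complex_scope.
Local Notation C := R[i].
Local Notation e := (nbasis n d m).
Local Notation tuple := {ffun option 'I_n -> 'M[C]_e}.

Definition hankel_tuple (c : C) (j : 'I_n) (b i : 'I_e) : tuple :=
  [ffun o => match o with
             | Some j' => if j' == j then c *: delta_mx b i else 0
             | None => - c *: delta_mx b (bshift j i)
             end].

Lemma tpair_hankel_tuple c j b i (H : tuple) :
  tpair (hankel_tuple c j b i) H =
  c * (H (Some j) b i - H None b (bshift j i)).
Proof.
rewrite tpairE ffunE mxpairZl mxpair_delta (bigD1 j) //= ffunE eqxx.
rewrite mxpairZl mxpair_delta big1 => [|j' jj'].
  by rewrite addr0 mulrBr mulNr addrC.
by rewrite ffunE (negPf jj') mxpair0.
Qed.

(* Two real equations (real and imaginary part) per Hankel relation. *)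
Definition hankel_eqs : seq tuple :=
  [seq if (size (bword x.2) < m)%N then
         hankel_tuple (if x.1.2 then 'i else 1) x.1.1.1 x.1.1.2 x.2
       else 0 | x <- enum {: 'I_n * 'I_e * bool * 'I_e}].

Lemma tpair0l (H : tuple) : tpair 0 H = 0.
Proof. by rewrite -(scale0r (0 : tuple)) tpairZl mul0r. Qed.

Lemma hankelP (H : tuple) :
  hankel H <-> forall l, complex.Re (tpair (nth 0 hankel_eqs l) H) = 0.
Proof.
split=> [hk l|eqs j b i im].
  have [ls|ls] := ltnP l (size hankel_eqs); last by rewrite nth_default // tpair0l.
  have /mapP[[[[j b] c] i] _ ->] := mem_nth 0 ls.
  case: ifP => [im|_]; last by rewrite tpair0l.
  by rewrite tpair_hankel_tuple hk // subrr mulr0.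
have eqs' c : complex.Re (tpair (hankel_tuple (if c then 'i else 1) j b i) H) = 0.
  have xs : hankel_tuple (if c then 'i else 1) j b i \in hankel_eqs.
    by apply/mapP; exists (j, b, c, i); rewrite ?mem_enum //= im.
  by rewrite -(nth_index 0 xs).
have := eqs' true; have := eqs' false; rewrite !tpair_hankel_tuple mul1r.
rewrite mulrC ReiNIm => re0 im0; apply/eqP; rewrite -subr_eq0 eq_complex.
by rewrite re0 -[complex.Im _]opprK im0 oppr0 !eqxx.
Qed.
End HankelEquations.

(** * From convexity to a pencil *)

Section ConvexImpliesSpectrahedron.
Local Open Scope complex_scope.
Variables (R : realType) (n d : nat) (f : 'M[ncpoly R n]_d).
Local Notation C := R[i].
Hypothesis d_gt0 : (0 < d)%N.
Hypothesis f_herm : mxstar f = f.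
Hypothesis f0_posdef : posdefmx (mxeval (0 : 'M[C]_1 ^ n) f).
Hypothesis f_cvx : free_convex (posdom f).

Lemma degree_bound :
  exists m, forall a b w, w \in msupp (f a b) -> (size w <= m)%N.
Proof.
exists (\max_a \max_b \max_(w <- msupp (f a b)) size w) => a b w wf.
apply: leq_trans (leq_bigmax a); apply: leq_trans (leq_bigmax b).
exact: leq_bigmax_seq.
Qed.

Lemma real_linear_tpair e (B : {ffun option 'I_n -> 'M[C]_e}) :
  real_linear (fun H => complex.Re (tpair B H)).
Proof.
split=> [H H'|t H]; first by rewrite tpairDr raddfD.
by rewrite tpairZr; case: (tpair B H) => x y /=; rewrite mul0r subr0.
Qed.

(* The convex Positivstellensatz for f, in dual form. *)
Lemma nonneg_extension m :
    (forall a b w, w \in msupp (f a b) -> (size w <= m)%N) ->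
  exists B : {ffun option 'I_n -> 'M[C]_(nbasis n d m)},
    (forall H, hankel H ->
       complex.Re (tpair B H) = complex.Re (tpair (poly_tuple m f) H)) /\
    (forall H, moment_cone f H -> 0 <= complex.Re (tpair B H)).
Proof.
move=> f_size; have [k [X [G [Q [Xf QG hk]]]]] := fock_moment m f_herm f0_posdef.
pose s := hankel_eqs R n d m.
pose chi l H := complex.Re (tpair (nth 0 s l) H).
have [|||||||lam lamP] := @multipliers R _ (moment_cone f (e := _)) (moment X G)
  _ _ _ (size s) chi (fun H => complex.Re (tpair (poly_tuple m f) H)).
- exact: moment_coneD.
- move=> t H t0; apply: moment_coneZ; rewrite ler0c; exact: ltW.
- exact: (moment_order_unit f_herm f0_posdef f_cvx Xf QG).
- exact: real_linear_tpair.
- by move=> l; exact: real_linear_tpair.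
- by move=> l; exact: (proj1 (hankelP _)).
- move=> H [k' [Y [G' [Yf ->]]]] eqs.
  suff /(moment_poly_ge0 f_size f_cvx Yf) : hankel (moment Y G').
    by rewrite lecE => /andP[].
  apply/hankelP => l; have [/eqs//|ls] := ltnP l (size s).
  by rewrite nth_default // tpair0l.
(* The added terms vanish, in real part, on Hankel tuples. *)
pose B := poly_tuple m f + \sum_(l < size s) (lam l)%:C *: nth 0 s l.
have BE H : complex.Re (tpair B H) =
    complex.Re (tpair (poly_tuple m f) H) + \sum_(l < size s) lam l * chi l H.
  rewrite tpairDl raddfD; congr (_ + _).
  elim/big_rec2: _ => [|l y A _ <-]; first by rewrite tpair0l.
  rewrite tpairDl tpairZl raddfD; congr (_ + _).
  by rewrite /chi; case: (tpair _ _) => x y' /=; rewrite mul0r subr0.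
exists B; split=> [H /hankelP hkH|H /lamP]; rewrite BE //.
by rewrite big1 ?addr0 // => l _; rewrite /chi hkH mulr0.
Qed.

(** [B] is nonnegative on all moments, so D_f lies in the domain of the pencil. Conversely, testing
    the pencil on the orbit of [g] gives a Hankel moment, on which [B] returns the form of f(X) at
    [g]. *)
Lemma convex_free_spectrahedron : free_spectrahedron (posdom f).
Proof.
have [m f_size] := degree_bound.
have [B [B_hk B_pos]] := nonneg_extension f_size.
(* The hermitian part of [B]: on hermitian tuples its pairing is the real part of that of [B]. *)
pose A : {ffun option 'I_n -> 'M[C]_(nbasis n d m)} :=
  2^-1 *: (B + [ffun i => (B i)^t*]).
have Ah i : (A i)^t* = A i.
  rewrite tupleZ tupleD ffunE adjZ adjD trmxCK addrC.
  by rewrite (CrealP _) ?ger0_real.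
have AE (H : {ffun option 'I_n -> 'M[C]_(nbasis n d m)}) :
    (forall i, (H i)^t* = H i) ->
    tpair A H = (complex.Re (tpair B H))%:C.
  by move=> Hh; rewrite tpairZl tpairDl tpair_adj // ReJ_add mulrC.
exists (nbasis n d m), (A None), (fun j => A (Some j)); split.
- by apply/card_gt0P; exists (insub_bseq m [::], Ordinal d_gt0).
- exact/hermP.
- by move=> j; exact/hermP.
move=> k; apply/funext => X; apply/propext.
apply: (iff_trans (posdomP _ _)); apply: (iff_trans _ (iff_sym (posdomP _ _))).
split=> [Xf|[Xh pos]].
  split=> [|G]; first exact: (proj1 Xf).
  rewrite qform_pencil_tuple AE => [|i]; last exact: moment_adj (proj1 Xf).
  by rewrite ler0c; apply: B_pos; exists k, X, G.
split=> // g; have hk : hankel (moment X (orbit m X g)).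
  by apply: hankel_moment => j i; exact: orbit_shift.
have := pos (orbit m X g); rewrite qform_pencil_tuple AE; last first.
  by move=> i; exact: moment_adj.
rewrite ler0c B_hk // (tpair_poly f_size _ (@col_orbit_index _ _ _ _ _ X g)).
by rewrite -ler0c RRe_real //; exact: qform_real.
Qed.
End ConvexImpliesSpectrahedron.

Theorem theorem5 (R : realType) (d n : nat) (f : 'M[ncpoly R n]_d)
    (d_gt0 : (0 < d)%N) (n_gt0 : (0 < n)%N)
    (f_herm : mxstar f = f)
    (f0_posdef : posdefmx (mxeval (0 : 'M[R[i]]_1 ^ n) f)) :
  free_convex (posdom f) <-> free_spectrahedron (posdom f).
Proof.
split; last exact: free_spectrahedron_convex.
exact: convex_free_spectrahedron.
Qed.
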